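(* Let $K,L\in\mathcal{S}_0$. For $\phi:(0,\infty)\to(0,\infty)$ write $F(t)=\phi(t^{-1/n})$, $t>0$. (i) For $\phi\in\Phi$, $$\widetilde{V}_{\phi}(K,L)\ge|K|\cdot\phi\big(|K|^{1/n}\cdot|L|^{-1/n}\big).$$ If in addition $F$ is strictly convex, equality holds if and only if $K$ and $L$ are dilates of each other. (ii) For $\phi\in\Psi$, $$\widetilde{V}_{\phi}(K,L)\le|K|\cdot\phi\big(|K|^{1/n}\cdot|L|^{-1/n}\big).$$ If in addition $F$ is strictly concave, equality holds if and only if $K$ and $L$ are dilates of each other.
   Context: Fix a positive integer $n$. A star body (about the origin) is a set $K\subset\mathbb{R}^n$ that contains the segment from the origin to each of its points and whose radial function $\rho_K(u)=\max\{\lambda:\lambda u\in K\}$, $u\in S^{n-1}$, is continuous and positive on $S^{n-1}$. $\mathcal{S}_0$ is the set of all star bodies. $K,L\in\mathcal{S}_0$ are dilates of each other if $L=\lambda K$ for some constant $\lambda>0$. $|K|$ denotes volume and $\sigma$ is the spherical measure on the unit sphere $S^{n-1}$. $\Phi$ is the set of functions $\phi:(0,\infty)\to(0,\infty)$ such that $F(t)=\phi(t^{-1/n})$ is either a constant or a convex function on $(0,\infty)$. $\Psi$ is the set of functions $\phi:(0,\infty)\to(0,\infty)$ such that $F(t)=\phi(t^{-1/n})$ is either a constant or an increasing concave function on $(0,\infty)$. (Such $\phi$ are automatically continuous.) For a continuous function $\phi:(0,\infty)\to(0,\infty)$ and $K,L\in\mathcal{S}_0$, the Orlicz $L_\phi$-dual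 mixed volume is $$\widetilde{V}_{\phi}(K,L)=\frac1n\int_{S^{n-1}}\phi\bigg(\frac{\rho_K(u)}{\rho_L(u)}\bigg)[\rho_K(u)]^n\,d\sigma(u).$$ *)

(* Defs.v *)
From HB Require Import structures.
From mathcomp Require Import all_boot all_order all_algebra.
From mathcomp Require Import interval_inference.
From mathcomp Require Import all_classical all_reals all_analysis.
From mathcomp Require Import measurable_realfun.

Set Implicit Arguments.
Unset Strict Implicit.
Unset Printing Implicit Defensive.

Import Order.TTheory GRing.Theory Num.Theory.
Import numFieldNormedType.Exports.

Local Open Scope classical_set_scope.
Local Open Scope ring_scope.

Definition measure_rV_display : measure_display -> measure_display.
Proof. exact. Qed.

(* 'rV[T]_n carries the product sigma-algebra, generated by the coordinates
   (as the library does for n.-tuple T); for T = R these are the Borel sets. *)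
Section measurable_rV.
Context {d} {T : measurableType d} (n : nat).

Let coors : 'I_n -> 'rV[T]_n -> T := fun i x => x ord0 i.

Let rV_set0 : g_sigma_preimage coors set0.
Proof. exact: sigma_algebra0. Qed.

Let rV_setC A : g_sigma_preimage coors A -> g_sigma_preimage coors (~` A).
Proof. exact: sigma_algebraC. Qed.

Let rV_bigcup (F : _^nat) : (forall i, g_sigma_preimage coors (F i)) ->
  g_sigma_preimage coors (\bigcup_i (F i)).
Proof. exact: sigma_algebra_bigcup. Qed.

HB.instance Definition _ := @isMeasurable.Build (measure_rV_display d)
  'rV[T]_n (g_sigma_preimage coors) rV_set0 rV_setC rV_bigcup.

End measurable_rV.

Section measurable_rV_fun.
Context d1 d2 (T1 : measurableType d1) (T2 : measurableType d2).

Lemma measurable_fun_rVP n (f : T1 -> 'rV[T2]_n) :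
  measurable_fun [set: T1] f <->
  forall i, measurable_fun [set: T1] (fun x => f x ord0 i).
Proof.
apply: (@iff_trans _ (g_sigma_preimage
    (fun i => (fun v : 'rV[T2]_n => v ord0 i) \o f) `<=` measurable)).
  rewrite g_sigma_preimage_comp; split=> [mf A [/= C preC <-]|prefS].
    exact: mf.
  by move=> _ A mA; apply: prefS; exists A.
split=> [fS i|mf].
- move=> _ A mA.
  apply: fS; apply: sub_sigma_algebra.
  case: n i => [[] []//|n i] in f *.
  rewrite -bigcup_mkord_ord.
  exists i; first exact: ltn_ord.
  by exists A => //; rewrite inord_val.
- apply: smallest_sub; first exact: sigma_algebra_measurable.
  case: n => [|n] in f mf *; first by rewrite big_ord0.
  rewrite -bigcup_mkord_ord; apply: bigcup_sub => i Ii.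
  by move=> A [B mB <-]; exact: mf.
Qed.

Lemma measurable_coord n (i : 'I_n) :
  measurable_fun [set: 'rV[T2]_n] (fun v : 'rV[T2]_n => v ord0 i).
Proof.
move=> _ A mA; apply: sub_sigma_algebra.
case: n i => [[] []//|n i].
rewrite -bigcup_mkord_ord; exists i; first exact: ltn_ord.
by exists A => //; rewrite inord_val.
Qed.

End measurable_rV_fun.

Section lebesgue_rV.
Context {R : realType}.

Definition rV_cons n (p : measurableTypeR R * 'rV[R]_n) : 'rV[R]_n.+1 :=
  row_mx (p.1)%:M p.2.

Definition rV_uncons n (v : 'rV[R]_n.+1) : measurableTypeR R * 'rV[R]_n :=
  (v ord0 ord0, \row_i v ord0 (lift ord0 i)).

Lemma rV_cons0 n p : @rV_cons n p ord0 ord0 = p.1.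
Proof.
have -> : ord0 = lshift n ord0 :> 'I_(1 + n) by exact/val_inj.
by rewrite [LHS](row_mxEl (p.1)%:M p.2) mxE eqxx.
Qed.

Lemma rV_consS n p i : @rV_cons n p ord0 (lift ord0 i) = p.2 ord0 i.
Proof.
have -> : lift ord0 i = rshift 1 i :> 'I_(1 + n) by exact/val_inj.
exact: (row_mxEr (p.1)%:M p.2).
Qed.

Lemma rV_consK n : cancel (@rV_cons n) (@rV_uncons n).
Proof.
case=> x v; rewrite /rV_uncons rV_cons0; congr pair.
by apply/rowP => i; rewrite mxE rV_consS.
Qed.

Lemma measurable_rV_cons n : measurable_fun setT (@rV_cons n).
Proof.
apply/measurable_fun_rVP => i.
case: (unliftP (ord0 : 'I_n.+1) i) => [j|] ->.
  under eq_fun do rewrite rV_consS.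
  apply: (@measurableT_comp _ _ _ _ _ _ (fun v : 'rV[R]_n => v ord0 j)) => //.
  exact: measurable_coord.
by under eq_fun do rewrite rV_cons0; exact: measurable_fst.
Qed.

Lemma measurable_rV_uncons n : measurable_fun setT (@rV_uncons n).
Proof.
apply/measurable_fun_pairP; split; first exact: measurable_coord.
apply/measurable_fun_rVP => i /=.
by under eq_fun do rewrite mxE; exact: measurable_coord.
Qed.

Section step.
Variables (n : nat) (mu : {sigma_finite_measure set 'rV[R]_n -> \bar R}).

Definition lebesgue_rV_step : set 'rV[R]_n.+1 -> \bar R :=
  pushforward (@lebesgue_measure R \x mu)%E (@rV_cons n).

Let step0 : lebesgue_rV_step set0 = 0%E.
Proof. by rewrite /lebesgue_rV_step /pushforward preimage_set0 measure0. Qed.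

Let step_ge0 A : (0 <= lebesgue_rV_step A)%E.
Proof. exact: (measure_ge0 (@lebesgue_measure R \x mu)%E). Qed.

Let step_sigma_additive : semi_sigma_additive lebesgue_rV_step.
Proof.
have mpre (A : set 'rV[R]_n.+1) : measurable A ->
    measurable (@rV_cons n @^-1` A).
  by move=> mA; rewrite -[X in measurable X]setTI; exact: measurable_rV_cons.
move=> F mF tF mUF; rewrite /lebesgue_rV_step /pushforward preimage_bigcup.
apply: measure_semi_sigma_additive => [i||].
- by apply: mpre.
- apply/trivIsetP => /= i j _ _ ij; rewrite -preimage_setI.
  by move/trivIsetP : tF => /(_ _ _ _ _ ij) ->//; rewrite preimage_set0.
- by rewrite -preimage_bigcup; exact: mpre.
Qed.

HB.instance Definition _ := isMeasure.Build _ _ _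
  lebesgue_rV_step step0 step_ge0 step_sigma_additive.

Let step_sigma_finite : sigma_finite setT lebesgue_rV_step.
Proof.
have /sigma_finiteP[F [TF ndF Foo]] := sigma_finiteT (@lebesgue_measure R).
have /sigma_finiteP[G [TG ndG Goo]] := sigma_finiteT mu.
exists (fun k => @rV_uncons n @^-1` (F k `*` G k)).
  apply/seteqP; split => // v _.
  have [i _ Fiv] : (\bigcup_i F i) (rV_uncons v).1 by rewrite -TF.
  have [j _ Gjv] : (\bigcup_j G j) (rV_uncons v).2 by rewrite -TG.
  exists (maxn i j) => //; split.
  - by move: Fiv; exact/subsetPset/ndF/leq_maxl.
  - by move: Gjv; exact/subsetPset/ndG/leq_maxr.
move=> k; have [mF Fk] := Foo k; have [mG Gk] := Goo k; split.
  rewrite -[X in measurable X]setTI; apply: measurable_rV_uncons => //.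
  exact: measurableX.
rewrite /lebesgue_rV_step /pushforward -comp_preimage.
rewrite (_ : _ \o _ = id); last by apply/funext => p; exact: rV_consK.
by rewrite preimage_id product_measure1E// lte_mul_pinfty// ge0_fin_numE.
Qed.

HB.instance Definition _ := Measure_isSigmaFinite.Build _ _ _
  lebesgue_rV_step step_sigma_finite.

End step.

(* n-dimensional Lebesgue measure: the n-fold product of lebesgue_measure,
   transported along R * R^n = R^(n+1). *)
Fixpoint lebesgue_rV n : {sigma_finite_measure set 'rV[R]_n -> \bar R} :=
  if n is m.+1 then lebesgue_rV_step (lebesgue_rV m)
  else \d_(0 : 'rV[R]_0).
End lebesgue_rV.

Section sphere.
Context {R : realType} {n : nat}.
Implicit Types x u : 'rV[R]_n.

(* The library norm on 'rV[R]_n is the sup norm. *)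
Definition enorm x : R := Num.sqrt (\sum_i x ord0 i ^+ 2).

Definition unit_sphere : set 'rV[R]_n := [set u | enorm u = 1].

Definition punctured_ball : set 'rV[R]_n := [set x | 0 < enorm x <= 1].

Definition radial_proj x : 'rV[R]_n := (enorm x)^-1 *: x.

Let sqnorm_ge0 x : 0 <= \sum_i x ord0 i ^+ 2.
Proof. by apply: sumr_ge0 => i _; exact: sqr_ge0. Qed.

Let measurable_sqnorm :
  measurable_fun setT (fun x => \sum_i x ord0 i ^+ 2 : R).
Proof.
apply: measurable_sum => i; apply: measurable_funX.
exact: measurable_coord.
Qed.

Lemma measurable_enorm : measurable_fun setT enorm.
Proof.
rewrite (_ : enorm = fun x => (\sum_i x ord0 i ^+ 2) `^ 2^-1).
  by apply: (measurableT_comp (measurable_powR _)); exact: measurable_sqnorm.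
by apply/funext => x; rewrite powR12_sqrt.
Qed.

Lemma measurable_punctured_ball : measurable punctured_ball.
Proof.
rewrite (_ : punctured_ball = setT `&` enorm @^-1` `]0, 1]).
  by apply: measurable_enorm => //; exact: measurable_itv.
by rewrite setTI; apply/seteqP; split => x /=; rewrite in_itv.
Qed.

Lemma measurable_radial_proj : measurable_fun setT radial_proj.
Proof.
apply/measurable_fun_rVP => i; rewrite /radial_proj.
under eq_fun do rewrite mxE.
apply: measurable_funM; last exact: measurable_coord.
rewrite (_ : (fun _ => _) = fun x => enorm x `^ (-1)).
  by apply: (measurableT_comp (measurable_powR _)); exact: measurable_enorm.
by apply/funext => x; rewrite powR_inv1// sqrtr_ge0.
Qed.

(* Spherical (surface area) measure, normalized by the polar coordinates
   formula: for A in the sphere, sigma A is n times the volume of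
   the cone {r u | u in A, 0 < r <= 1} over A. It is a measure on 'rV[R]_n
   concentrated on unit_sphere. *)
Definition spherical_measure (A : set 'rV[R]_n) : \bar R :=
  (n%:R%:E * lebesgue_rV n (radial_proj @^-1` A `&` punctured_ball))%E.

Let spherical0 : spherical_measure set0 = 0%E.
Proof.
by rewrite /spherical_measure preimage_set0 set0I measure0 mule0.
Qed.

Let spherical_ge0 A : (0 <= spherical_measure A)%E.
Proof. by rewrite /spherical_measure mule_ge0// lee_fin. Qed.

Let spherical_sigma_additive : semi_sigma_additive spherical_measure.
Proof.
have mpre (A : set 'rV[R]_n) : measurable A ->
    measurable (radial_proj @^-1` A `&` punctured_ball).
  move=> mA; apply: measurableI; last exact: measurable_punctured_ball.
  by rewrite -[X in measurable X]setTI; exact: measurable_radial_proj.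
move=> F mF tF mUF; rewrite /spherical_measure.
rewrite preimage_bigcup setI_bigcupl.
under eq_fun do rewrite -ge0_sume_distrr//.
apply: cvgeZl => //.
apply: measure_semi_sigma_additive => [i||].
- by apply: mpre.
- apply: trivIset_setIr; apply/trivIsetP => /= i j _ _ ij.
  rewrite -preimage_setI.
  by move/trivIsetP : tF => /(_ _ _ _ _ ij) ->//; rewrite preimage_set0.
- by rewrite -setI_bigcupl -preimage_bigcup; exact: mpre.
Qed.

HB.instance Definition _ := isMeasure.Build _ _ _
  spherical_measure spherical0 spherical_ge0 spherical_sigma_additive.

End sphere.

Section star_bodies.
Context {R : realType} {n : nat}.
Implicit Types (K L : set 'rV[R]_n) (u x : 'rV[R]_n) (phi : R -> R).

(* The maximum of {l | l u in K}, when it exists; star_body requires it to. *)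
Definition radial K u : R := sup [set l | K (l *: u)].

Definition has_max (A : set R) := exists m, A m /\ ubound A m.

Definition star_body K :=
  [/\ forall x, K x -> forall t : R, 0 <= t <= 1 -> K (t *: x),
      forall u, unit_sphere u -> has_max [set l | K (l *: u)],
      {within unit_sphere, continuous (radial K)} &
      forall u, unit_sphere u -> 0 < radial K u].

Definition dilates K L := exists2 l : R, 0 < l & L = [set l *: x | x in K].

(* A star body has finite volume, so fine loses nothing. *)
Definition volume K : R := fine (lebesgue_rV n K).

Definition dual_mixed_volume phi K L : R :=
  n%:R^-1 * \int[@spherical_measure R n]_(u in unit_sphere)
    (phi (radial K u / radial L u) * radial K u ^+ n).

End star_bodies.

Section function_classes.
Context {R : realType}.
Local Open Scope convex_scope.
Implicit Types f phi : R -> R.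

Definition posR : set R := `]0, +oo[.

Definition concave_function (D : set R) f := convex_function D (fun x => - f x).

Definition strictly_convex_function (D : set R) f :=
  forall t : {i01 R}, 0 < t%:num < 1 ->
    {in D &, forall x y : R^o, x != y ->
      (f (x <| t |> y) : R^o) < (f x : R^o) <| t |> (f y : R^o)}.

Definition strictly_concave_function (D : set R) f :=
  strictly_convex_function D (fun x => - f x).

Definition constant_on (D : set R) f := exists c, {in D, forall t, f t = c}.

(* Weakly increasing; this covers the strict reading too. *)
Definition increasing_on (D : set R) f := {in D &, {homo f : x y / x <= y}}.

Definition orlicz_F (n : nat) phi : R -> R :=
  fun t => phi (t `^ (- n%:R^-1)).

(* phi matters only on (0, oo): its values elsewhere are unconstrained. *)
Definition Phi (n : nat) : set (R -> R) := [set phi |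
  {in posR, forall t, 0 < phi t} /\
  (constant_on posR (orlicz_F n phi) \/
   convex_function posR (orlicz_F n phi))].

Definition Psi (n : nat) : set (R -> R) := [set phi |
  {in posR, forall t, 0 < phi t} /\
  (constant_on posR (orlicz_F n phi) \/
   (increasing_on posR (orlicz_F n phi) /\
    concave_function posR (orlicz_F n phi)))].

End function_classes.

(* Main.v *)
Require Import Defs.
From mathcomp Require Import all_boot all_order all_algebra.
From mathcomp Require Import all_classical all_reals all_analysis.
From mathcomp Require Import measurable_realfun ring lra.

Set Implicit Arguments.
Unset Strict Implicit.
Unset Printing Implicit Defensive.

Import Order.TTheory GRing.Theory Num.Theory.
Import numFieldNormedType.Exports.

Local Open Scope classical_set_scope.
Local Open Scope ring_scope.

(** Polar coordinates give [n |K| = \int rho_K^n dsigma]: the cone measure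
    [A |-> n |{x in K : x/|x| in A}|] lies between [a sigma(A)] and [b sigma(A)]
    whenever [a <= rho_K^n <= b] on [A], so its density is [rho_K^n].
    Since [phi(rho_K/rho_L) = F(rho_L^n/rho_K^n)], the inequality is Jensen's
      for
    [F] (or for [-F]) and the weight [rho_K^n], whose barycenter is [|L|/|K|];
    it follows by integrating a support line at that point. If [F] is strictly
    convex, equality forces [rho_L^n/rho_K^n] to be almost everywhere constant,
    hence constant, because [sigma] charges every nonempty open subset of the
    sphere; and proportional radial functions mean dilates. *)

(** * Convex functions on the positive half-line *)

Section convex_on_posR.
Context {R : realType}.
Implicit Types (G : R -> R) (x y t s c : R).

Lemma posRE x : (x \in posR) = (0 < x).
Proof. by apply/idP/idP; rewrite inE /posR /= in_itv/= andbT. Qed.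

Lemma convex_posR_le G x y s : convex_function posR G ->
  0 < x -> 0 < y -> 0 <= s -> s <= 1 ->
  G (s * x + (1 - s) * y) <= s * G x + (1 - s) * G y.
Proof.
move=> cG x0 y0 s0 s1.
by have := cG (Itv01 s0 s1) x y; rewrite !posRE => /(_ x0 y0).
Qed.

(** The midpoint case of strict convexity is the form in which the equality case uses it. *)
Lemma strictly_convex_posR_lt G x y : strictly_convex_function posR G ->
  0 < x -> 0 < y -> x != y -> G ((x + y) / 2) < (G x + G y) / 2.
Proof.
move=> cG x0 y0 xy.
have h0 : (0 : R) <= 2^-1 by rewrite invr_ge0.
have h1 : (2^-1 : R) <= 1 by rewrite invf_le1// ler1n.
have h01 : 0 < (Itv01 h0 h1)%:num < 1 by rewrite /= invr_gt0 ltr0n /= invf_lt1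
  ?ltr1n ?ltr0n.
have := cG _ h01 x y; rewrite !posRE => /(_ x0 y0 xy).
rewrite !convRE /= /unstable.onem.
by rewrite (_ : 2^-1 * x + _ = (x + y) / 2) 1?(_ : 2^-1 * G x + _ = (G x + G y)
  / 2)//; field.
Qed.

Lemma convex_slope_le G x t y : convex_function posR G ->
  0 < x -> x < t -> t < y ->
  (G t - G x) / (t - x) <= (G y - G t) / (y - t).
Proof.
move=> cG x0 xt ty.
have yx : 0 < y - x by rewrite subr_gt0 (lt_trans xt).
have tx : 0 < t - x by rewrite subr_gt0.
have yt : 0 < y - t by rewrite subr_gt0.
(* [(y - t) / (y - x)] is the weight of [x] when [t] is written as a convex combination of [x] and
   [y]. *)
have s0 : 0 <= (y - t) / (y - x) by rewrite divr_ge0 ?ltW.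
have s1 : (y - t) / (y - x) <= 1 by rewrite ler_pdivrMr// mul1r lerD2l lerN2
  ltW.
have := convex_posR_le cG x0 (lt_trans x0 (lt_trans xt ty)) s0 s1.
rewrite (_ : _ * x + _ = t); last by field; rewrite gt_eqF.
rewrite -(ler_pM2r yx).
rewrite [leRHS](_ : _ = (y - t) * G x + (t - x) * G y); last first.
  by field; rewrite gt_eqF.
move=> H; rewrite ler_pdivrMr// mulrAC ler_pdivlMr//; nra.
Qed.

(** The slope [c] is the supremum of the slopes of chords ending at [t] from the left. Each chord
    leaving [t] to the right bounds that set, by [convex_slope_le]; so the line lies below [G] on
    both sides. *)
Lemma convex_support_line G t : convex_function posR G -> 0 < t ->
  exists c, forall x, 0 < x -> G t + c * (x - t) <= G x.
Proof.
move=> cG t0.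
pose A := [set (G t - G x) / (t - x) | x in [set x | 0 < x < t]].
have A0 : A !=set0.
  exists ((G t - G (t / 2)) / (t - t / 2)), (t / 2) => //=; apply/andP; split;
    lra.
have ubA y : t < y -> ubound A ((G y - G t) / (y - t)).
  by move=> ty _ [x /= /andP[x0 xt] <-]; exact: convex_slope_le.
have hA : has_sup A by split => //; exists ((G (t + 1) - G t) / (t + 1 - t));
  apply: ubA; lra.
exists (sup A) => x x0; have [xt|tx|->] := ltgtP x t;
  last by rewrite subrr mulr0 addr0.
  have : (G t - G x) / (t - x) <= sup A.
    by apply: sup_upper_bound => //; exists x => //=; rewrite x0.
  by rewrite ler_pdivrMr ?subr_gt0//; lra.
have : sup A <= (G x - G t) / (x - t) by apply: ge_sup => //; exact: ubA.
by rewrite ler_pdivlMr ?subr_gt0//; lra.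
Qed.

(** A second point of contact [x] would put the midpoint of [x] and [t] strictly below the line,
    against the support inequality there. *)
Lemma strictly_convex_support_line G t c : strictly_convex_function posR G ->
  0 < t -> (forall x, 0 < x -> G t + c * (x - t) <= G x) ->
  forall x, 0 < x -> x != t -> G t + c * (x - t) < G x.
Proof.
move=> sG t0 cG x x0 xt.
have := strictly_convex_posR_lt sG x0 t0 xt.
have := cG ((x + t) / 2); rewrite divr_gt0 ?addr_gt0// => /(_ isT); lra.
Qed.

Lemma segment_conv a b x : a <= x <= b ->
  exists s, [/\ 0 <= s, s <= 1 & x = s * a + (1 - s) * b].
Proof.
move=> /andP[ax xb]; have [ab|ab] := eqVneq a b.
  by exists 0; rewrite lexx ler01; split => //; lra.
have ba : 0 < b - a by rewrite subr_gt0 lt_neqAle ab (le_trans ax).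
exists ((b - x) / (b - a)); split; last by field; rewrite gt_eqF.
  by rewrite divr_ge0 ?subr_ge0// ltW// -subr_gt0.
by rewrite ler_pdivrMr// mul1r lerD2l lerN2.
Qed.

(** Sublevel sets of a convex function are intervals, and the rays []-oo, r[] generate the Borel
    sets. *)
Lemma convex_measurable G : convex_function posR G ->
  measurable_fun (posR : set R) G.
Proof.
move=> cG; apply: (measurability (@RGenInftyO.G R)) => [|/= _ [_] [r] -> <-].
  exact: RGenInftyO.measurableE.
apply: is_interval_measurable => x y [] /=.
rewrite /posR /= !in_itv/= !andbT => x0 Gx [y0 Gy] z xzy.
have [s [s0 s1 zE]] := segment_conv xzy; split.
  by rewrite in_itv/= andbT (lt_le_trans x0)//; case/andP: xzy.
rewrite in_itv/= zE (le_lt_trans (convex_posR_le cG x0 y0 s0 s1))//.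
(* A positive weight on [G x < r] makes the combination strict; with weight zero, [G y < r] does. *)
have [->|s0'] := eqVneq s 0; first by lra.
have {}s0' : 0 < s by rewrite lt_def s0'.
nra.
Qed.

(** The chord over [[a, b]] bounds [G] from above and the support line at [a] bounds it from
    below. *)
Lemma convex_bounded G a b : convex_function posR G -> 0 < a ->
  exists M, forall x, a <= x <= b -> `|G x| <= M.
Proof.
move=> cG a0; have [c cP] := convex_support_line cG a0.
exists (`|G a| + `|G b| + `|c| * `|b - a|) => x axb.
have [ax xb] := andP axb; have x0 := lt_le_trans a0 ax.
have [s [s0 s1 xE]] := segment_conv axb.
have b0 := lt_le_trans x0 xb.
have up : G x <= `|G a| + `|G b|.
  rewrite xE (le_trans (convex_posR_le cG a0 b0 s0 s1))// lerD//.
    by rewrite (le_trans (ler_norm _))// normrM ger0_norm// ler_piMl.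
  rewrite (le_trans (ler_norm _))// normrM ger0_norm ?subr_ge0//.
  by rewrite ler_piMl// lerBlDr lerDl.
rewrite ler_norml; apply/andP; split; last first.
  by rewrite (le_trans up)// lerDl mulr_ge0.
have H : `|c * (x - a)| <= `|c| * `|b - a|.
  by rewrite normrM ler_wpM2l// !ger0_norm ?subr_ge0 ?lerD2r// (le_trans ax).
have H1 : - `|G a| <= G a by rewrite lerNl -normrN ler_norm.
have H2 : - `|c * (x - a)| <= c * (x - a) by rewrite lerNl -normrN ler_norm.
have := cP x x0; have := normr_ge0 (G b); lra.
Qed.

End convex_on_posR.

(** * Lebesgue measure on R^n *)

Section lebesgue_rV_theory.
Context {R : realType}.

Let pushm d d' (T1 : measurableType d) (T2 : measurableType d')
    (m : {measure set T1 -> \bar R}) (f : T1 -> T2)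
    (mf : measurable_fun setT f) : {measure set T2 -> \bar R} :=
  measure_function_pushforward__canonical__measure_function_Measure m mf.

(** The image measure, multiplied by [t], has the right value on every interval []a, b]], which
    characterizes Lebesgue measure. *)
Lemma lebesgue_measure_preimage_scale (t : R) (A : set (measurableTypeR R)) :
  0 < t -> measurable A ->
  lebesgue_measure ((fun x : measurableTypeR R => t * x : measurableTypeR R)
    @^-1` A) =
  ((t^-1)%:E * lebesgue_measure A)%E.
Proof.
move=> t0 mA.
pose f := fun x : measurableTypeR R => t * x : measurableTypeR R.
have mf : measurable_fun setT f by exact: measurable_funM.
have -> : lebesgue_measure A =
    mscale (NngNum (ltW t0)) (pushm lebesgue_measure mf) A.
  apply: lebesgue_measure_unique => // _ [[a b]] _ <- /=.
  rewrite /mscale /= /pushforward.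
  rewrite (_ : f @^-1` _ = `]a / t, b / t]%classic); last first.
    apply/seteqP; split => x /=;
      by rewrite !in_itv/= ltr_pdivrMr// ler_pdivlMr// ![_ * t]mulrC.
  rewrite !lebesgue_measure_itv/= !lte_fin ltr_pM2r ?invr_gt0//.
  case: ifPn => _; last by rewrite mule0.
  by rewrite -!EFinB -EFinM; congr EFin; field; rewrite gt_eqF.
by rewrite /mscale /= muleA -EFinM mulVf ?gt_eqF// mul1e.
Qed.

Lemma measurable_scale_rV n (t : R) :
  measurable_fun setT (fun x : 'rV[R]_n => t *: x).
Proof.
apply/measurable_fun_rVP => i; under eq_fun do rewrite mxE.
by apply: measurable_funM => //; exact: measurable_coord.
Qed.

Lemma lebesgue_rV_succ n (A : set 'rV[R]_n.+1) :
  lebesgue_rV n.+1 A = (lebesgue_measure \x lebesgue_rV n)%E (@rV_cons R n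
    @^-1` A).
Proof. by []. Qed.

Lemma measurable_preimage_rV_cons n (A : set 'rV[R]_n.+1) :
  measurable A -> measurable (@rV_cons R n @^-1` A).
Proof.
by move=> mA; rewrite -[X in measurable X]setTI; exact: measurable_rV_cons.
Qed.

Lemma rV_cons_scale n (t : R) (p : measurableTypeR R * 'rV[R]_n) :
  t *: rV_cons p = rV_cons (t * p.1, t *: p.2).
Proof.
apply/rowP => i; case: (unliftP (ord0 : 'I_n.+1) i) => [j|] ->.
  by rewrite mxE !rV_consS/= mxE.
by rewrite mxE !rV_cons0.
Qed.

(** Induction on the dimension through the splitting of R^(n+1) as R times R^n; R^0 is a single
    point, fixed by scaling. *)
Lemma lebesgue_rV_preimage_scale n (t : R) (A : set 'rV[R]_n) :
  0 < t -> measurable A ->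
  lebesgue_rV n ((fun x : 'rV[R]_n => t *: x) @^-1` A) =
  ((t ^- n)%:E * lebesgue_rV n A)%E.
Proof.
elim: n A => [A t0 mA|n IH A t0 mA].
  rewrite expr0 invr1 mul1e /= !diracE /=; congr (_%:R%:E : \bar R).
  by rewrite (_ : _ @^-1` A = A)//; apply/seteqP; split => x /=;
    rewrite [t *: x]thinmx0 [x]thinmx0.
rewrite !lebesgue_rV_succ.
pose g := fun p : measurableTypeR R * 'rV[R]_n =>
  (t * p.1 : measurableTypeR R, t *: p.2).
have mg : measurable_fun setT g.
  apply/measurable_fun_pairP; split.
    exact: measurable_funM.
  exact: (measurableT_comp (measurable_scale_rV t) measurable_snd).
have tn0 : 0 <= t ^+ n.+1 by rewrite exprn_ge0 ?ltW.
rewrite (_ : _ @^-1` _ = g @^-1` (@rV_cons R n @^-1` A)); last first.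
  by apply/seteqP; split => p /=; rewrite rV_cons_scale.
(* The rescaled image of the product measure agrees with it on rectangles, each side contributing
   its own scaling factor; uniqueness extends this to all measurable sets. *)
have H := @product_measure_unique _ _ _ _ R (@lebesgue_measure R) (lebesgue_rV
  n)
  (mscale (NngNum tn0) (pushm (lebesgue_measure \x lebesgue_rV n)%E mg)).
rewrite [in RHS]H; last 2 first.
- move=> B C mB mC.
  pose B' := (fun x : measurableTypeR R => t * x : measurableTypeR R) @^-1` B.
  pose C' := (fun x : 'rV[R]_n => t *: x) @^-1` C.
  rewrite [LHS](_ : _ = ((t ^+ n.+1)%:E *
    ((lebesgue_measure \x lebesgue_rV n) (B' `*` C')))%E)//.
  rewrite product_measure1E; last 2 first.
  + by rewrite -[X in measurable X]setTI; exact: measurable_funM.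
  + by rewrite -[X in measurable X]setTI; exact: measurable_scale_rV.
  transitivity ((t ^+ n.+1)%R%:E * ((t^-1)%R%:E * lebesgue_measure B *
      ((t ^- n)%R%:E * lebesgue_rV n C)))%E.
    congr (_ * (_ * _))%E; last exact: IH.
    exact: lebesgue_measure_preimage_scale.
  rewrite muleACA -EFinM !muleA -EFinM exprS -invfM mulfV ?mul1e//.
  by rewrite mulf_neq0// ?expf_neq0// gt_eqF.
- exact: measurable_preimage_rV_cons.
by rewrite /mscale /= muleA -EFinM mulVf ?mul1e// expf_neq0// gt_eqF.
Qed.

(** For the sup norm a ball is a cube. Positivity of [r] matters when [n = 0], where the condition
    on coordinates is vacuous. *)
Lemma ball_rVE n (x : 'rV[R]_n) r y : 0 < r ->
  ball x r y <-> forall i, ball (x ord0 i) r (y ord0 i).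
Proof.
by move=> r0; split => [[_ + i]|H]; [exact|split => // i j; rewrite ord1].
Qed.

Lemma measurable_ball_rV n (x : 'rV[R]_n) r : measurable (ball x r).
Proof.
have [r0|r0] := ltP 0 r; last first.
  by rewrite (_ : ball x r = set0)//; apply/seteqP;
    split => // y [/lt_le_trans/(_ r0)]; rewrite ltxx.
rewrite (_ : ball x r = \bigcap_(i in [set: 'I_n]) ((fun y : 'rV[R]_n => y ord0
  i) @^-1` ball (x ord0 i) r)); last first.
  apply/seteqP; split => y; first by move/(ball_rVE _ _ r0) => H i _; exact: H.
  by move=> H; apply/(ball_rVE _ _ r0) => i; exact: H.
apply: fin_bigcap_measurable => // i _.
by rewrite -[X in measurable X]setTI; apply: measurable_coord => //;
  exact: measurable_ball.
Qed.

Lemma lebesgue_rV_ball n (x : 'rV[R]_n) r : 0 < r ->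
  lebesgue_rV n (ball x r) = ((r *+ 2) ^+ n)%:E.
Proof.
move=> r0; elim: n x => [x|n IH x].
  by rewrite /= diracE mem_set//; apply/ball_rVE => // -[].
rewrite lebesgue_rV_succ (_ : _ @^-1` _ = ball (x ord0 ord0) r `*`
    ball (\row_i x ord0 (lift ord0 i)) r); last first.
  apply/seteqP; split => -[a v] /=.
    move=> /(ball_rVE _ _ r0) H; split; first by have := H ord0;
      rewrite rV_cons0.
    by apply/(ball_rVE _ _ r0) => i; have := H (lift ord0 i);
      rewrite rV_consS mxE.
  move=> [/= xa /(ball_rVE _ _ r0) H]; apply/(ball_rVE _ _ r0) => i.
  case: (unliftP (ord0 : 'I_n.+1) i) => [j|] ->; last by rewrite rV_cons0.
  by rewrite rV_consS; have := H j; rewrite mxE.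
rewrite product_measure1E; last 2 first.
- exact: measurable_ball.
- exact: measurable_ball_rV.
rewrite IH exprS EFinM; congr (_ * _)%E.
by rewrite -(lebesgue_measure_ball (x ord0 ord0)) ?ltW.
Qed.

(** The sigma-algebra comes from the coordinates, so an open set is exhibited as a countable union
    of cubes with rational centers and radii. *)
Lemma open_measurable_rV n (U : set 'rV[R]_n) : open U -> measurable U.
Proof.
move=> oU.
pose toR (q : 'rV[rat]_n) : 'rV[R]_n := \row_i ratr (q ord0 i).
pose B (p : 'rV[rat]_n * rat) : set 'rV[R]_n := ball (toR p.1) (ratr p.2).
rewrite (_ : U = \bigcup_(p in [set p | B p `<=` U]) B p); last first.
  apply/seteqP; split => [x Ux|x [p /= BU /BU]//].
  have /nbhs_ballP[e /= e0 eU] : nbhs x U by exact: open_nbhs_nbhs.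
  (* With a radius below [e / 2], any cube of that radius containing [x] stays within distance [e]
     of [x]. *)
  have /rat_in_itvoo[r] : 0 < e / 2 by rewrite divr_gt0.
  rewrite in_itv/= => /andP[r0 re].
  have /choice[q qP] : forall i, exists q : rat, ball (x ord0 i) (ratr r) (ratr
    q : R).
    move=> i; have /rat_in_itvoo[q] : x ord0 i - ratr r < x ord0 i + ratr r.
      by rewrite ltrD2l gtrN.
    rewrite in_itv /= => qr; exists q; rewrite /ball/= distrC ltr_distl.
    by [].
  have xB : ball (toR (\row_i q i)) (ratr r) x.
    by apply/ball_rVE => // i; rewrite !mxE; apply: ball_sym; exact: qP.
  exists (\row_i q i, r) => //= y By; apply: eU.
  apply: (@le_ball _ _ _ (ratr r + ratr r)); first by lra.
  by apply: (@ball_triangle _ _ (toR (\row_i q i))) => //; exact: ball_sym.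
rewrite bigcup_mkcond; apply: countable_bigcupT_measurable => [|p];
  first exact: countableP.
by case: ifPn => // _; exact: measurable_ball_rV.
Qed.

End lebesgue_rV_theory.

(** * The sphere and its cone measure *)

Section sphere_theory.
Context {R : realType} {n : nat}.
Implicit Types (x u : 'rV[R]_n) (t : R).

Lemma enorm_ge0 x : 0 <= enorm x.
Proof. exact: sqrtr_ge0. Qed.

Lemma enormZ t x : enorm (t *: x) = `|t| * enorm x.
Proof.
rewrite /enorm -sqrtr_sqr -sqrtrM ?sqr_ge0// mulr_sumr; congr Num.sqrt.
by apply: eq_bigr => i _; rewrite mxE exprMn.
Qed.

Lemma coord_le_enorm x i : `|x ord0 i| <= enorm x.
Proof.
rewrite -sqrtr_sqr ler_wsqrtr// (bigD1 i)//= lerDl.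
by apply: sumr_ge0 => j _; exact: sqr_ge0.
Qed.

Lemma enorm0 : enorm (0 : 'rV[R]_n) = 0.
Proof. by rewrite -(scale0r (0 : 'rV[R]_n)) enormZ normr0 mul0r. Qed.

Lemma enorm_eq0 x : (enorm x == 0) = (x == 0).
Proof.
apply/eqP/eqP => [x0|->]; last exact: enorm0.
apply/rowP => i; rewrite mxE; apply/eqP.
by rewrite -normr_le0 (le_trans (coord_le_enorm x i))// x0.
Qed.

Lemma enorm_gt0 x : (0 < enorm x) = (x != 0).
Proof. by rewrite lt_def enorm_ge0 andbT enorm_eq0. Qed.

Lemma radial_proj_sphere x : x != 0 -> unit_sphere (radial_proj x).
Proof.
move=> x0; rewrite /unit_sphere /radial_proj /= enormZ ger0_norm ?invr_ge0
  ?enorm_ge0//.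
by rewrite mulVf// enorm_eq0.
Qed.

Lemma radial_projZ t x : 0 < t -> radial_proj (t *: x) = radial_proj x.
Proof.
move=> t0; rewrite /radial_proj enormZ scalerA gtr0_norm//.
have [->|x0] := eqVneq x 0; first by rewrite !scaler0.
by rewrite invfM mulrAC mulVf ?mul1r// gt_eqF.
Qed.

Lemma radial_proj_id u : unit_sphere u -> radial_proj u = u.
Proof. by rewrite /unit_sphere /radial_proj /= => ->;
  rewrite invr1 scale1r. Qed.

Lemma enorm_radial_proj x : enorm x *: radial_proj x = x.
Proof.
rewrite /radial_proj scalerA; have [->|x0] := eqVneq x 0;
  first by rewrite scaler0.
by rewrite divff ?scale1r// enorm_eq0.
Qed.

Lemma unit_sphere_neq0 u : unit_sphere u -> u != 0.
Proof. by rewrite /unit_sphere/= => u1; rewrite -enorm_gt0 u1. Qed.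

Lemma enorm_continuous : continuous (@enorm R n).
Proof.
have cs : continuous (fun x : 'rV[R]_n => \sum_i x ord0 i ^+ 2 : R).
  apply: continuous_big => [|i _ x]; first exact: add_continuous.
  apply: (@continuous_comp _ _ _ (fun x : 'rV[R]_n => x ord0 i) (fun y => y ^+
    2)).
    exact: coord_continuous.
  exact: exprn_continuous.
by move=> x; apply: (continuous_comp (cs x)); exact: sqrt_continuous.
Qed.

Lemma radial_proj_continuous x : x != 0 -> {for x, continuous (@radial_proj R
  n)}.
Proof.
move=> x0; have ci : (enorm y)^-1 @[y --> x] --> (enorm x)^-1.
  by apply: (cvgV _ (@enorm_continuous x)); rewrite enorm_eq0.
rewrite /prop_for /continuous_at /radial_proj.
have := @cvgZ R 'rV[R]_n _ (nbhs x) _ _ (fun y : 'rV[R]_n => y) _ x ci.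
by apply; exact: cvg_id.
Qed.

Lemma compact_unit_sphere : compact (@unit_sphere R n).
Proof.
apply: bounded_closed_compact.
  exists 1; split => // M M1 x; rewrite /unit_sphere /= => x1.
  rewrite /Num.norm /= mx_normrE; apply/bigmax_leP; split;
    first by rewrite (le_trans _ (ltW M1)).
  move=> [i j] _ /=; rewrite ord1 (le_trans (coord_le_enorm _ _))// x1.
  exact: ltW.
rewrite (_ : unit_sphere = @enorm R n @^-1` [set 1]); last by [].
apply: preimage_closed => [x _|]; [exact: enorm_continuous|exact: closed_eq].
Qed.

Lemma measurable_unit_sphere : measurable (@unit_sphere R n).
Proof.
rewrite (_ : unit_sphere = setT `&` @enorm R n @^-1` [set 1]);
  last by rewrite setTI.
exact: measurable_enorm.
Qed.

Lemma within_continuous_measurable_rV (D : set 'rV[R]_n) (f : 'rV[R]_n -> R) :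
  measurable D -> {within D, continuous f} -> measurable_fun D f.
Proof.
move=> mD /continuousP cf; apply: (measurability (@RGenOpens.G R)) => [|/= _
  [_] [a [b ->]] <-].
  exact: RGenOpens.measurableE.
have /cf/open_subspaceP[V oV VD] : open (`]a, b[%classic : set R) by exact:
  interval_open.
rewrite setIC -VD; apply: measurableI => //; exact: open_measurable_rV.
Qed.

Lemma spherical_measure_fin : (spherical_measure [set: 'rV[R]_n] < +oo)%E.
Proof.
apply: lte_mul_pinfty => //.
rewrite (@le_lt_trans _ _ (lebesgue_rV n (ball (0 : 'rV[R]_n) 2)))//.
  apply: le_measure; rewrite ?inE.
  - by rewrite preimage_setT setTI; exact: measurable_punctured_ball.
  - exact: measurable_ball_rV.
  - move=> x [_ /andP[_ x1]]; apply/ball_rVE => // i.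
    rewrite mxE /ball /= sub0r normrN (le_lt_trans (coord_le_enorm _ _))//.
    by rewrite (le_lt_trans x1)// ltr1n.
by rewrite lebesgue_rV_ball// ltry.
Qed.

(** The cone over a neighborhood of [u] in the sphere contains a small ball, whose volume is
    positive. *)
Lemma spherical_measure_open_gt0 (A : set 'rV[R]_n) u e : (0 < n)%N ->
  measurable A -> unit_sphere u -> 0 < e ->
  (forall v, unit_sphere v -> ball u e v -> A v) ->
  (0 < spherical_measure A)%E.
Proof.
move=> n0 mA uS e0 uA; rewrite /spherical_measure mule_gt0//.
  by rewrite lte_fin ltr0n.
(* [u] lies on the boundary of the unit ball; half of it is an interior point with the same
   direction. *)
pose z := 2^-1 *: u.
have h0 : (0 : R) < 2^-1 by rewrite invr_gt0.
have z0 : z != 0 by rewrite scaler_eq0 negb_or gt_eqF//= unit_sphere_neq0.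
have zu : radial_proj z = u by rewrite radial_projZ// radial_proj_id.
have z1 : enorm z = 2^-1 by rewrite enormZ gtr0_norm// uS mulr1.
have : nbhs z [set x | ball u e (radial_proj x)].
  apply: (radial_proj_continuous z0); rewrite zu.
  exact: nbhsx_ballx.
move=> H2; have /(@enorm_continuous z) H1 : nbhs (enorm z) [set y : R | y \in
  `]0, 1[].
  by apply: near_in_itvoo; rewrite z1 in_itv/= h0 invf_lt1 ?ltr1n ?ltr0n.
have /nbhs_ballP[d /= d0 dP] : nbhs z ([set x | ball u e (radial_proj x)] `&`
    [set x | enorm x \in `]0, 1[]) by exact: filterI H2 H1.
apply: (@lt_le_trans _ _ (lebesgue_rV n (ball z d))).
  by rewrite lebesgue_rV_ball// lte_fin exprn_gt0// pmulrn_lgt0.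
apply: le_measure; rewrite ?inE.
- exact: measurable_ball_rV.
- apply: measurableI; last exact: measurable_punctured_ball.
  by rewrite -[X in measurable X]setTI; exact: measurable_radial_proj.
- move=> x /dP[/= xe]; rewrite in_itv/= => /andP[x0 x1]; split => /=.
    by apply: uA => //; apply: radial_proj_sphere; rewrite -enorm_gt0.
  by rewrite /punctured_ball /= x0 ltW.
Qed.

Lemma measurable_rV_origin : measurable [set (0 : 'rV[R]_n)].
Proof.
rewrite (_ : [set _] = setT `&` @enorm R n @^-1` [set 0]);
  first exact: measurable_enorm.
by rewrite setTI; apply/seteqP; split => x /= /eqP;
  rewrite ?enorm_eq0 => /eqP // ->; exact: enorm0.
Qed.

(* The cone over [A] truncated where [enorm x ^+ n = b]; in this normalization
   its volume is linear in [b]. *)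
Definition cone (A : set 'rV[R]_n) (b : R) : set 'rV[R]_n :=
  [set x | [/\ 0 < enorm x, enorm x ^+ n <= b & A (radial_proj x)]].

Lemma lebesgue_rV_cone A b : (0 < n)%N -> measurable A -> 0 <= b ->
  (n%:R%:E * lebesgue_rV n (cone A b) = b%:E * spherical_measure A)%E.
Proof.
move=> n0 mA; rewrite le_eqVlt => /predU1P[<-|b0].
  rewrite mul0e (_ : cone A 0 = set0) ?measure0 ?mule0//.
  apply/seteqP; split => // x [x0 + _].
  by rewrite leNgt exprn_gt0.
(* Scaling by [t] carries [cone A b] onto the unit cone that defines [spherical_measure A], and
   [t ^+ n = b^-1] is the change of volume. *)
pose t := b `^ (- n%:R^-1).
have t0 : 0 < t by rewrite powR_gt0.
have tn : t ^+ n = b^-1.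
  by rewrite -powR_mulrn ?powR_ge0// -powRrM mulNr mulVf ?pnatr_eq0 ?gtn_eqF//
    powR_inv1 ?ltW.
rewrite /spherical_measure muleCA; congr (_ * _)%E.
rewrite (_ : cone A b = (fun x => t *: x) @^-1` (radial_proj @^-1` A `&`
  punctured_ball)).
  rewrite lebesgue_rV_preimage_scale// ?tn ?invrK//.
  apply: measurableI; last exact: measurable_punctured_ball.
  by rewrite -[X in measurable X]setTI; exact: measurable_radial_proj.
apply/seteqP; split => x /=;
  rewrite /cone /punctured_ball /= radial_projZ// enormZ gtr0_norm//.
  move=> [x0 xb Ax]; split => //; rewrite mulr_gt0//=.
  rewrite -(@expr_le1 _ n)//; last by rewrite mulr_ge0 ?ltW.
  by rewrite exprMn tn ler_pdivrMl ?mulr1.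
move=> [Ax /andP[tx0]]; have x0 : 0 < enorm x by rewrite pmulr_rgt0 in tx0.
rewrite -(@expr_le1 _ n)//; last by rewrite mulr_ge0 ?ltW.
by rewrite exprMn tn ler_pdivrMl// mulr1.
Qed.

End sphere_theory.

Lemma lebesgue_rV_origin (R : realType) n :
  (0 < n)%N -> lebesgue_rV n [set (0 : 'rV[R]_n)] = 0%E.
Proof.
case: n => // m _; rewrite lebesgue_rV_succ.
rewrite (_ : _ @^-1` _ = [set (0 : measurableTypeR R)] `*` [set 0]).
  rewrite product_measure1E//; last exact: measurable_rV_origin.
  have := @lebesgue_measure_set1 R 0 => /= ->.
  by rewrite mul0e.
apply/seteqP; split => -[a v] /=.
  move=> /rowP av; split; first by have := av ord0; rewrite rV_cons0 mxE.
  by apply/rowP => i; have := av (lift ord0 i); rewrite rV_consS !mxE.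
move=> [-> ->]; apply/rowP => i; rewrite [RHS]mxE.
case: (unliftP (ord0 : 'I_m.+1) i) => [j|] ->; last by rewrite rV_cons0.
by rewrite rV_consS mxE.
Qed.

(** * Squeezed measures *)

Section integral_of_density.
Context {R : realType} {d : measure_display} {T : measurableType d}.

Lemma integral_bigsetU_ord (nu : {measure set T -> \bar R}) (g : T -> R) (D :
  set T)
    (F : nat -> set T) N :
  measurable_fun D g -> (forall x, D x -> 0 <= g x) -> measurable D ->
  (forall k, measurable (F k)) -> trivIset setT F ->
  (forall k, F k `<=` D) ->
  (\int[nu]_(x in \big[setU/set0]_(k < N) F k) (g x)%:E =
   \sum_(k < N) \int[nu]_(x in F k) (g x)%:E)%E.
Proof.
move=> mg g0 mD mF tF FD.
have UD : \big[setU/set0]_(k < N) F k `<=` D.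
  by rewrite -bigcup_mkord; apply: bigcup_sub => k _; exact: FD.
apply: (@ge0_integral_bigsetU _ _ _ _ 'I_N (fun k => F k)) => //.
- exact: index_enum_uniq.
- apply/trivIsetP => i j _ _ ij; move/trivIsetP : tF; exact.
- by apply/measurable_EFinP; exact: measurable_funS mg.
- by move=> x /UD Dx; rewrite lee_fin g0.
Qed.

(** This identifies [g] as the density of [mu] with respect to [nu] on [D], directly from two-sided
    bounds on the sets where [g] is pinched. *)
Lemma integral_squeeze (nu mu : {measure set T -> \bar R}) (D : set T)
    (g : T -> R) (M : R) :
  measurable D -> (nu D < +oo)%E -> measurable_fun D g ->
  (forall x, D x -> 0 <= g x < M) ->
  (forall (A : set T) (a b : R), measurable A -> A `<=` D -> 0 <= a -> a <= b ->
    (forall x, A x -> a <= g x <= b) ->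
    (a%:E * nu A <= mu A)%E /\ (mu A <= b%:E * nu A)%E) ->
  mu D = (\int[nu]_(x in D) (g x)%:E)%E.
Proof.
move=> mD nuD mg gM mu_sq.
have g0 x : D x -> 0 <= g x by move=> /gM/andP[].
(* Slices of [D] on which [g] oscillates by at most [e]; summed over them, both
   sides agree up to [e * nu D]. *)
pose A e k := D `&` g @^-1` `[k%:R * e, k.+1%:R * e[.
have mA e k : measurable (A e k) by exact: mg.
have AD e k : A e k `<=` D by move=> x [].
(* These two properties hold for [mu] and for the integral of [g], and the comparison uses only
   them; being symmetric, it yields both inequalities. *)
pose addsq (m : set T -> \bar R) :=
  (forall (F : nat -> set T) (N : nat), (forall k, measurable (F k)) ->
    trivIset setT F -> (forall k, F k `<=` D) ->
    (m (\big[setU/set0]_(k < N) F k) = \sum_(k < N) m (F k))%E) /\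
  (forall (A : set T) (a b : R), measurable A -> A `<=` D -> 0 <= a -> a <= b ->
    (forall x, A x -> a <= g x <= b) ->
    (a%:E * nu A <= m A)%E /\ (m A <= b%:E * nu A)%E).
have approx (m1 m2 : set T -> \bar R) :
    addsq m1 -> addsq m2 ->
    forall e, 0 < e -> (m1 D <= m2 D + e%:E * nu D)%E.
  move=> [add1 sq1] [add2 sq2] e e0.
  (* Since [g < M], the slice index [truncn (g x / e)] is at most [truncn (M / e)], so [N] slices
     cover [D]. *)
  pose N := (Num.truncn (M / e)).+1.
  have tA : trivIset setT (A e).
    apply/trivIsetP => i j _ _; wlog ij : i j / (i < j)%N => [wl ij|].
      by have [/wl|/wl|E] := ltngtP i j; [exact|rewrite setIC; apply;
        rewrite eq_sym|rewrite E eqxx in ij].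
    move=> _; apply/seteqP; split => // x [[_ /=]] /[swap] -[_ /=].
    rewrite !in_itv/= => /andP[jx _] /andP[_ xi].
    have := le_lt_trans jx xi; rewrite ltr_pM2r// ltr_nat ltnS leqNgt.
    by rewrite ij.
  have DE : D = \big[setU/set0]_(k < N) A e k.
    rewrite -bigcup_mkord; apply/seteqP; split => [x Dx|x [k _ /AD//]].
    have ge0 : 0 <= g x / e by rewrite divr_ge0 ?g0 ?ltW.
    exists (Num.truncn (g x / e)) => /=.
      rewrite /N ltnS le_truncn// ler_pM2r ?invr_gt0// ltW//.
      by have /andP[] := gM x Dx.
    split => //=; rewrite in_itv/= -ler_pdivlMr// -ltr_pdivrMr//.
    exact: truncn_itv.
  rewrite {1 2 3}DE add1// add2// measure_bigsetU// ge0_sume_distrr//.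
  rewrite -big_split/=; apply: lee_sum => k _.
  have k0 : 0 <= k%:R * e by rewrite mulr_ge0// ltW.
  have kk : k%:R * e <= k.+1%:R * e by rewrite ler_wpM2r ?ltW// ltr_nat.
  have Ab x : A e k x -> k%:R * e <= g x <= k.+1%:R * e.
    by move=> [_ /=]; rewrite in_itv/= => /andP[-> /ltW].
  (* On a slice, [m1] is at most [(k + 1) e nu], which is [k e nu + e nu], and [k e nu] is at most
     [m2]. *)
  have [_ /le_trans] := sq1 _ _ _ (mA e k) (@AD e k) k0 kk Ab; apply.
  have [+ _] := sq2 _ _ _ (mA e k) (@AD e k) k0 kk Ab.
  rewrite -natr1 mulrDl mul1r EFinD ge0_muleDl ?lee_fin ?(ltW e0)//.
  by move=> H; exact: leeD.
have limit (x y : \bar R) : (forall e, 0 < e -> (x <= y + e%:E * nu D)%E) -> (x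
  <= y)%E.
  move=> H; apply/lee_addgt0Pr => e e0.
  have nuf : nu D \is a fin_num by rewrite ge0_fin_numE.
  have s0 : 0 <= fine (nu D) by rewrite fine_ge0.
  have s1 : 0 < fine (nu D) + 1 by rewrite ltr_wpDl.
  (* The added 1 keeps the denominator positive when [nu D] vanishes. *)
  have := H (e / (fine (nu D) + 1)); rewrite divr_gt0// => /(_ isT)/le_trans;
    apply.
  by rewrite leeD2l// -(fineK nuf) -EFinM lee_fin mulrAC ler_pdivrMr//
    ler_wpM2l ?lerDl// ltW.
pose m2 B := (\int[nu]_(x in B) (g x)%:E)%E.
have sq_mu : addsq mu.
  by split => // F N mF tF _; rewrite measure_bigsetU.
have sq_m2 : addsq m2.
  split.
  - by move=> F N mF tF FD; exact: (@integral_bigsetU_ord nu g D).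
  - move=> B a b mB BD a0 ab gab; have mgB : measurable_fun B (EFin \o g).
      by apply/measurable_EFinP; exact: measurable_funS mg.
    have H x : B x -> [/\ (0 <= a%:E)%E, (0 <= b%:E)%E, (0 <= (g x)%:E)%E,
        (a%:E <= (g x)%:E)%E & ((g x)%:E <= b%:E)%E].
      move=> Bx; rewrite !lee_fin; have /andP[ag gb] := gab x Bx.
      by split => //; [exact: le_trans ab|exact/g0/BD].
    split; rewrite -integral_cst//; apply: ge0_le_integral => // x Bx;
      by have [] := H x Bx.
apply/eqP; rewrite eq_le; apply/andP; split; apply: limit => e e0.
  exact: (approx mu m2).
exact: (approx m2 mu).
Qed.

End integral_of_density.

(** * A weighted Jensen inequality *)

Section weighted_jensen.
Context {R : realType} {d : measure_display} {T : measurableType d}.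
Variables (mu : {measure set T -> \bar R}) (D : set T) (w v : T -> R) (G : R ->
  R).
Hypotheses (mD : measurable D)
  (iw : mu.-integrable D (EFin \o w)) (iv : mu.-integrable D (EFin \o v))
  (iG : mu.-integrable D (EFin \o (fun x => G (v x / w x) * w x)))
  (w0 : forall x, D x -> 0 < w x) (v0 : forall x, D x -> 0 < v x)
  (W0 : 0 < \int[mu]_(x in D) w x) (V0 : 0 < \int[mu]_(x in D) v x).

Let t := \int[mu]_(x in D) v x / \int[mu]_(x in D) w x.
Let t0 : 0 < t. Proof. exact: divr_gt0. Qed.
(** This is the support line of slope [c] at [t], evaluated at [v x / w x] and multiplied by the
    weight [w x]. *)
Let f c := fun x => (G t - c * t) * w x + c * v x.

Let iZ a (h : T -> R) : mu.-integrable D (EFin \o h) ->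
  mu.-integrable D (EFin \o (fun x => a * h x)).
Proof.
move=> ih; rewrite (_ : _ \o _ = fun x => (a%:E * (h x)%:E)%E)//.
exact: integrableZl.
Qed.

Let if_ c : mu.-integrable D (EFin \o f c).
Proof.
pose f1 := fun x => (G t - c * t) * w x; pose f2 := fun x => c * v x.
rewrite (_ : _ \o _ = (EFin \o f1) \+ (EFin \o f2))%E//.
by apply: integrableD => //; exact: iZ.
Qed.

(** The terms in [c] cancel because [t] is the barycenter of [v / w] for the weight [w]. *)
Let int_f c : \int[mu]_(x in D) f c x = G t * \int[mu]_(x in D) w x.
Proof.
rewrite RintegralD//; [|exact: iZ..].
rewrite !RintegralZl//; have := mulfVK (lt0r_neq0 W0) (\int[mu]_(x in D) v x).
rewrite -/t => <-; ring.
Qed.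

Let le_f c : (forall y, 0 < y -> G t + c * (y - t) <= G y) ->
  forall x, D x -> f c x <= G (v x / w x) * w x.
Proof.
move=> cP x Dx; have wx := w0 Dx.
have := cP (v x / w x); rewrite divr_gt0 ?v0// => /(_ isT).
rewrite -(ler_pM2r wx); apply: le_trans; rewrite le_eqVlt; apply/orP; left.
by apply/eqP; rewrite /f; field; rewrite gt_eqF.
Qed.

Lemma weighted_jensen : convex_function posR G ->
  G t * \int[mu]_(x in D) w x <= \int[mu]_(x in D) (G (v x / w x) * w x).
Proof.
move=> cG; have [c cP] := convex_support_line cG t0.
by rewrite -(int_f c); apply: le_Rintegral => //; exact: le_f.
Qed.

Lemma weighted_jensen_eq : convex_function posR G ->
  strictly_convex_function posR G ->
  \int[mu]_(x in D) (G (v x / w x) * w x) = G t * \int[mu]_(x in D) w x ->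
  \forall x \ae mu, D x -> v x = t * w x.
Proof.
move=> cG sG E; have [c cP] := convex_support_line cG t0.
(* In the equality case this nonnegative function has integral zero, so it vanishes almost
   everywhere; strictness of the support line then leaves only [v x / w x = t]. *)
pose gap x := G (v x / w x) * w x - f c x.
have igap : mu.-integrable D (EFin \o gap).
  pose f1 := fun x => G (v x / w x) * w x.
  rewrite (_ : _ \o _ = (EFin \o f1) \- (EFin \o f c))%E//.
  exact: integrableB.
have gap0 x : D x -> 0 <= gap x by move=> Dx; rewrite subr_ge0 le_f.
have : (\int[mu]_(x in D) `|(EFin \o gap) x| = 0)%E.
  rewrite (eq_integral (EFin \o gap)); last first.
    by move=> x; rewrite inE => /gap0 g0; rewrite /= ger0_norm.
  rewrite -(fineK (integrable_fin_num mD igap)); congr EFin.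
  by rewrite -/(Rintegral mu D gap) RintegralB// E int_f subrr.
move/(ae_eq_integral_abs _ mD (measurable_int _ igap)).
apply: filterS => x /= + Dx => /(_ Dx) [gx].
have wx := w0 Dx; have vw : 0 < v x / w x by rewrite divr_gt0 ?v0.
have [vt|vt] := eqVneq (v x / w x) t; first by rewrite -vt divfK// gt_eqF.
have := strictly_convex_support_line sG t0 cP vw vt.
rewrite -(ltr_pM2r wx) => H; move: gx; rewrite /gap => /eqP.
rewrite subr_eq0 => /eqP gE; move: H; rewrite gE /f.
suff -> : (G t + c * (v x / w x - t)) * w x = (G t - c * t) * w x + c * v x by
  rewrite ltxx.
by field; rewrite gt_eqF.
Qed.

End weighted_jensen.

(** * Volumes in polar coordinates *)

Section polar_coordinates.
Context {R : realType} {n : nat}.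
Implicit Types (g : 'rV[R]_n -> R) (K : set 'rV[R]_n) (x u : 'rV[R]_n).

Lemma unit_sphere_nonempty : (0 < n)%N -> (@unit_sphere R n) !=set0.
Proof.
move=> n0; exists (radial_proj (const_mx 1)); apply: radial_proj_sphere.
apply/eqP => /rowP/(_ (Ordinal n0)); rewrite !mxE => /eqP.
by rewrite oner_eq0.
Qed.

Lemma spherical_measure_sphere_fin : (spherical_measure (@unit_sphere R n) <
  +oo)%E.
Proof.
apply: le_lt_trans spherical_measure_fin; apply: le_measure => //;
  rewrite inE //.
exact: measurable_unit_sphere.
Qed.

(** [g] stands for the n-th power of a radial function, so that [g] itself is the density in polar
    coordinates. The origin, which has no direction, is left out. *)
Definition polar_body g : set 'rV[R]_n :=
  [set x | 0 < enorm x /\ enorm x ^+ n <= g (radial_proj x)].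

Lemma measurable_polar_body g :
  measurable_fun unit_sphere g -> measurable (polar_body g).
Proof.
move=> mg; pose D := [set x : 'rV[R]_n | 0 < enorm x].
have mD : measurable D.
  rewrite (_ : D = setT `&` @enorm R n @^-1` `]0, +oo[).
    by apply: measurable_enorm => //; exact: measurable_itv.
  by rewrite setTI; apply/seteqP; split => x /=; rewrite in_itv/= andbT.
have mh : measurable_fun D (fun x => enorm x ^+ n <= g (radial_proj x)).
  apply: measurable_fun_ler.
    by apply: measurable_funX; apply: measurable_funS (@measurable_enorm R n).
  apply: (@measurable_comp _ _ _ _ _ _ unit_sphere g) => //.
  - exact: measurable_unit_sphere.
  - by move=> _ [x /= x0 <-]; apply: radial_proj_sphere; rewrite -enorm_gt0.
  - by apply: measurable_funS (@measurable_radial_proj R n).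
rewrite (_ : polar_body g = D `&` (fun x => enorm x ^+ n <= g (radial_proj x))
  @^-1` [set true]).
  exact: mh.
by [].
Qed.

Lemma measurable_cone (A : set 'rV[R]_n) b : measurable A -> measurable (cone A
  b).
Proof.
move=> mA; rewrite (_ : cone A b = polar_body (cst b) `&` (setT `&` radial_proj
  @^-1` A)).
  apply: measurableI; first by apply: measurable_polar_body;
    exact: measurable_cst.
  exact: measurable_radial_proj.
by rewrite setTI; apply/seteqP; split => x /=; [case|case => -[]].
Qed.

Lemma polar_coordinates g (M : R) : (0 < n)%N -> measurable_fun unit_sphere g ->
  (forall u, unit_sphere u -> 0 <= g u < M) ->
  (n%:R%:E * lebesgue_rV n (polar_body g) =
   \int[@spherical_measure R n]_(u in unit_sphere) (g u)%:E)%E.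
Proof.
move=> n0 mg gM; have mE := measurable_polar_body mg.
(* [m1], [m2] and [m3] build, as a measure, [n] times the volume of the part of the body lying over
   a set of directions. *)
pose m1 : {measure set 'rV[R]_n -> \bar R} := mrestr (lebesgue_rV n) mE.
pose m2 : {measure set 'rV[R]_n -> \bar R} :=
  measure_function_pushforward__canonical__measure_function_Measure m1
    (@measurable_radial_proj R n).
have nn0 : 0 <= n%:R :> R by [].
pose m3 : {measure set 'rV[R]_n -> \bar R} := mscale (NngNum nn0) m2.
have m3E A : m3 A = (n%:R%:E * lebesgue_rV n (radial_proj @^-1` A `&`
  polar_body g))%E by [].
have mpre A : measurable A -> measurable (radial_proj @^-1` A `&` polar_body g).
  move=> mA; apply: measurableI => //.
  by rewrite -[X in measurable X]setTI; exact: measurable_radial_proj.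
rewrite -(@integral_squeeze _ _ _ (@spherical_measure R n) m3 unit_sphere g
  M)//.
- rewrite m3E (_ : _ `&` _ = polar_body g)//.
  apply/seteqP; split => x; first by case.
  move=> [x0 xg]; split => //.
  by apply: radial_proj_sphere; rewrite -enorm_gt0.
- exact: measurable_unit_sphere.
- exact: spherical_measure_sphere_fin.
(* If [a <= g <= b] on [A], the part of the body over [A] lies between the cones [cone A a] and
   [cone A b], whose volumes are known. *)
- move=> A a b mA AS a0 ab gab;
  rewrite -!lebesgue_rV_cone// ?(le_trans a0)// m3E.
  have mp := mpre A mA; have mc c := measurable_cone c mA.
  split; apply: lee_wpmul2l; rewrite ?lee_fin//; apply: le_measure;
    rewrite ?inE// => x.
    by move=> [x0 xa Ax]; split => //; split => //; rewrite (le_trans xa)//;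
      case/andP: (gab _ Ax).
  by move=> [Ax [x0 xg]]; split => //; rewrite (le_trans xg)//;
    case/andP: (gab _ Ax).
Qed.

(** * Star bodies through their radial functions *)

Lemma star_body_rayP K u (l : R) : star_body K -> unit_sphere u -> 0 <= l ->
  K (l *: u) <-> l <= radial K u.
Proof.
move=> [Kseg Kmax _ Kpos] uS l0; have [m [Km mub]] := Kmax _ uS.
have rm : radial K u = m.
  apply/eqP; rewrite eq_le; apply/andP; split; first by apply: ge_sup => //;
    exists m.
  by apply: ub_le_sup => //; exists m.
split => [Kl|lr]; first by rewrite rm; exact: mub.
have r0 := Kpos _ uS.
(* The maximum is attained, so [l *: u] lies on the segment from the origin to a point of [K]. *)
rewrite (_ : l *: u = (l / radial K u) *: (radial K u *: u)).
  apply: Kseg; first by rewrite rm.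
  by rewrite (divr_ge0 l0 (ltW r0))/= ler_pdivrMr ?mul1r.
by rewrite scalerA divfK// gt_eqF.
Qed.

Lemma star_bodyP K x : star_body K -> x != 0 ->
  K x <-> enorm x <= radial K (radial_proj x).
Proof.
move=> hK x0; rewrite -{1}(enorm_radial_proj x).
apply: star_body_rayP => //; [exact: radial_proj_sphere|exact: enorm_ge0].
Qed.

Lemma star_body0 K : (0 < n)%N -> star_body K -> K 0.
Proof.
move=> n0 hK; have [u uS] := unit_sphere_nonempty n0.
rewrite -(scale0r u); apply/(star_body_rayP hK uS) => //.
by case: hK => _ _ _ /(_ _ uS)/ltW.
Qed.

Lemma radial_measurable K : star_body K -> measurable_fun unit_sphere (radial
  K).
Proof.
move=> [_ _ cK _]; apply: within_continuous_measurable_rV => //.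
exact: measurable_unit_sphere.
Qed.

(** The sphere is compact and [radial K] is continuous; its minimum is attained, hence positive. *)
Lemma star_body_bounds K : (0 < n)%N -> star_body K ->
  exists a b : R, 0 < a /\ forall u, unit_sphere u -> a <= radial K u <= b.
Proof.
move=> n0 [_ _ cK Kpos]; have S0 := unit_sphere_nonempty n0.
have [p pS pmax] := EVT_max_rV S0 compact_unit_sphere cK.
have [q qS qmin] := EVT_min_rV S0 compact_unit_sphere cK.
exists (radial K q), (radial K p); rewrite inE in qS; split; first exact: Kpos.
by move=> u uS; rewrite qmin ?inE// pmax ?inE.
Qed.

Lemma integrable_radialX K : (0 < n)%N -> star_body K ->
  (@spherical_measure R n).-integrable unit_sphere (EFin \o (fun u => radial K
    u ^+ n)).
Proof.
move=> n0 hK; have [a [b [a0 ab]]] := star_body_bounds n0 hK.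
apply: measurable_bounded_integrable.
- exact: measurable_unit_sphere.
- exact: spherical_measure_sphere_fin.
- by apply: measurable_funX; exact: radial_measurable.
- exists (b ^+ n); split=> [|M bM u uS /=]; first exact: num_real.
  have /andP[ra rb] := ab u uS; have r0 := le_trans (ltW a0) ra.
  by rewrite ger0_norm ?exprn_ge0// (le_trans _ (ltW bM))// lerXn2r ?nnegrE//
    (le_trans r0).
Qed.

(** The two sets differ only by the origin, a null set in positive dimension. *)
Lemma star_body_lebesgue K : (0 < n)%N -> star_body K ->
  lebesgue_rV n K = lebesgue_rV n (polar_body (fun u => radial K u ^+ n)).
Proof.
move=> n0 hK; set E := polar_body _.
have mE : measurable E.
  by apply: measurable_polar_body; apply: measurable_funX;
    exact: radial_measurable.
rewrite (_ : K = E `|` [set 0]).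
  rewrite measureU//; last 2 first.
  - exact: measurable_rV_origin.
  - apply/seteqP; split => // x [[+ _] /= x0]; by rewrite x0 enorm0 ltxx.
  by rewrite [X in (_ + X)%E]lebesgue_rV_origin// adde0.
have Epos x : x != 0 -> (K x <-> E x).
  move=> x0; rewrite star_bodyP// /E /polar_body /= enorm_gt0 x0.
  have r0 : 0 <= radial K (radial_proj x).
    by apply: ltW; case: hK => _ _ _; apply; exact: radial_proj_sphere.
  have -> : (enorm x ^+ n <= radial K (radial_proj x) ^+ n) =
      (enorm x <= radial K (radial_proj x)).
    by rewrite ler_pXn2r ?nnegrE ?enorm_ge0.
  by split => [|[]].
apply/seteqP; split => x; have [->|x0] := eqVneq x 0.
- by right.
- by move/(Epos _ x0); left.
- by move=> _; exact: star_body0.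
- by move=> [/(Epos _ x0)//|/eqP]; rewrite (negPf x0).
Qed.

Lemma volume_polar K : (0 < n)%N -> star_body K ->
  n%:R * volume K = \int[@spherical_measure R n]_(u in unit_sphere) radial K u
    ^+ n.
Proof.
move=> n0 hK; have [a [b [a0 ab]]] := star_body_bounds n0 hK.
have pol : (n%:R%:E * lebesgue_rV n K =
    \int[@spherical_measure R n]_(u in unit_sphere) (radial K u ^+ n)%:E)%E.
  rewrite star_body_lebesgue// (@polar_coordinates _ (b ^+ n + 1))//.
    by apply: measurable_funX; exact: radial_measurable.
  move=> u uS; have /andP[ra rb] := ab u uS; have r0 := le_trans (ltW a0) ra.
  by rewrite exprn_ge0//= (@le_lt_trans _ _ (b ^+ n)) ?ltrDl// lerXn2r
    ?nnegrE// (le_trans r0).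
have fin := integrable_fin_num measurable_unit_sphere (integrable_radialX n0
  hK).
rewrite /Rintegral -pol /volume.
(* The integral is finite, so the volume is not infinite and [fine] returns its actual value. *)
move: pol fin => /= <-; case: (lebesgue_rV n K) => [r| |] //=.
- by rewrite gt0_muley ?lte_fin ?ltr0n.
- by rewrite gt0_muleNy ?lte_fin ?ltr0n.
Qed.

(** The polar formula bounds [n |K|] below by [a ^+ n] times the measure of the sphere, with [a] a
    positive lower bound of the radial function. *)
Lemma volume_gt0 K : (0 < n)%N -> star_body K -> 0 < volume K.
Proof.
move=> n0 hK; have [a [b [a0 ab]]] := star_body_bounds n0 hK.
have [u uS] := unit_sphere_nonempty n0.
have n0' : 0 < n%:R :> R by rewrite ltr0n.
rewrite -(pmulr_rgt0 _ n0') volume_polar//.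
have s0 : 0 < fine (spherical_measure (@unit_sphere R n)).
  apply: fine_gt0; rewrite spherical_measure_sphere_fin andbT.
  by apply: (@spherical_measure_open_gt0 _ _ _ u 1) => //;
    exact: measurable_unit_sphere.
apply: (@lt_le_trans _ _ (a ^+ n * fine (spherical_measure (@unit_sphere R
  n)))).
  by rewrite mulr_gt0// exprn_gt0.
rewrite -Rintegral_cst; last exact: measurable_unit_sphere.
apply: le_Rintegral => //.
- exact: measurable_unit_sphere.
- apply: measurable_bounded_integrable => //.
  + exact: measurable_unit_sphere.
  + exact: spherical_measure_sphere_fin.
  + by exists (a ^+ n); split=> [|M aM v _ /=];
    [exact: num_real|rewrite ger0_norm ?exprn_ge0 ?ltW].
- exact: integrable_radialX.
- move=> v vS; have /andP[ra rb] := ab v vS.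
  by apply: lerXn2r => //; rewrite nnegrE ltW// (lt_le_trans a0).
Qed.

End polar_coordinates.

(** * Dual mixed volumes *)

Section dual_mixed_volume_theory.
Context {R : realType} {n : nat}.
Hypothesis n_gt0 : (0 < n)%N.
Implicit Types (K L : set 'rV[R]_n) (u x : 'rV[R]_n) (phi G : R -> R).

Let n0 : n%:R != 0 :> R. Proof. by rewrite pnatr_eq0 gtn_eqF. Qed.

(** This puts the integrand in the form [G (v / w) * w] of [weighted_jensen], with [v] and [w] the
    n-th powers of the radial functions of [L] and [K]. *)
Lemma orlicz_F_ratio phi (a b : R) : 0 < a -> 0 < b ->
  orlicz_F n phi (b ^+ n / a ^+ n) = phi (a / b).
Proof.
move=> a0 b0; rewrite /orlicz_F; congr phi.
have r0 : 0 < a / b by rewrite divr_gt0.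
rewrite -expr_div_n -invf_div exprVn -powR_mulrn ?ltW// -powRN -powRrM.
by rewrite mulNr mulrN opprK mulfV// powRr1// ltW.
Qed.

Lemma orlicz_F_volume phi (a b : R) : 0 < a -> 0 < b ->
  orlicz_F n phi (b / a) = phi (a `^ n%:R^-1 * b `^ (- n%:R^-1)).
Proof.
move=> a0 b0; rewrite /orlicz_F; congr phi.
rewrite powRM ?invr_ge0 ?ltW// mulrC; congr (_ * _).
by rewrite -powR_inv1 ?ltW// -powRrM mulrNN mul1r.
Qed.

(** A star body is recovered from its radial function, so the identity of sets and that of functions
    translate into each other ray by ray. *)
Lemma dilatesP K L : star_body K -> star_body L ->
  dilates K L <->
  exists2 l : R, 0 < l & forall u, unit_sphere u -> radial L u = l * radial K u.
Proof.
move=> hK hL; have rK u : unit_sphere u -> 0 < radial K u by case: hK => _ _ _;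
  exact.
have rL u : unit_sphere u -> 0 < radial L u by case: hL => _ _ _; exact.
split => [[l l0 LE]|[l l0 lP]]; exists l => //.
  have lP t u : L (t *: u) <-> K ((t / l) *: u).
    rewrite LE; split => [[y Ky yE]|Kt].
      rewrite mulrC -scalerA -yE scalerA mulVf ?scale1r//.
      by rewrite gt_eqF.
    by exists ((t / l) *: u) => //;
      rewrite scalerA mulrCA mulfV ?mulr1// gt_eqF.
  move=> u uS; have lK0 : 0 <= l * radial K u by rewrite mulr_ge0 ?ltW ?rK.
  apply/eqP; rewrite eq_le; apply/andP; split.
    rewrite -ler_pdivrMl// mulrC; apply/(star_body_rayP hK uS).
      by rewrite divr_ge0 ?ltW ?rL.
    by apply/lP/(star_body_rayP hL uS); rewrite ?lexx// ltW ?rL.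
  apply/(star_body_rayP hL uS) => //; apply/lP.
  by rewrite mulrAC mulfV ?mul1r ?gt_eqF//; apply/(star_body_rayP hK uS);
    rewrite ?lexx// ltW ?rK.
have lK x : L x <-> K (l^-1 *: x).
  (* The origin lies on no particular ray, but it belongs to both bodies. *)
  have [->|x0] := eqVneq x 0; first by rewrite scaler0; split => _;
    exact: star_body0.
  have lx0 : l^-1 *: x != 0 by rewrite scaler_eq0 negb_or invr_eq0 gt_eqF.
  have li0 : 0 < l^-1 by rewrite invr_gt0.
  rewrite (star_bodyP hL x0) (star_bodyP hK lx0) radial_projZ// enormZ
    gtr0_norm//.
  by rewrite lP ?ler_pdivrMl//; exact: radial_proj_sphere.
apply/seteqP; split => [x /lK Kx|_ [x Kx <-]].
  by exists (l^-1 *: x) => //; rewrite scalerA mulfV ?scale1r// gt_eqF.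
by apply/lK; rewrite scalerA mulVf ?scale1r// gt_eqF.
Qed.

(** If [f u] were nonzero, continuity would put a whole neighborhood of [u] in the sphere inside the
    exceptional null set, but such neighborhoods have positive measure. *)
Lemma ae_unit_sphere_eq0 (f : 'rV[R]_n -> R) : {within unit_sphere, continuous
  f} ->
  (\forall u \ae @spherical_measure R n, unit_sphere u -> f u = 0) ->
  forall u, unit_sphere u -> f u = 0.
Proof.
move=> /subspace_continuousP cf [N [mN N0 fN]] u uS; apply/eqP/negPn/negP => fu.
have /(cf u uS) : nbhs (f u) [set y : R | y != 0].
  by apply: open_nbhs_nbhs; split => //; exact: open_neq.
move=> /nbhs_ballP[e /= e0 eP].
have : (0 < spherical_measure N)%E.
  apply: (spherical_measure_open_gt0 n_gt0 mN uS e0) => v vS uv.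
  by apply: fN => /= H; have /eqP := eP v uv vS; apply; exact: H.
by rewrite [X in (0 < X)%E -> _]N0 ltxx.
Qed.

(** Bounds on the two radial functions confine the ratio to a compact interval of positive numbers,
    where the convex [G] is bounded. *)
Lemma integrable_convex_ratio G K L : convex_function posR G ->
  star_body K -> star_body L ->
  (@spherical_measure R n).-integrable unit_sphere
    (EFin \o (fun u => G (radial L u ^+ n / radial K u ^+ n) * radial K u ^+
      n)).
Proof.
move=> cG hK hL.
have [aK [bK [aK0 abK]]] := star_body_bounds n_gt0 hK.
have [aL [bL [aL0 abL]]] := star_body_bounds n_gt0 hL.
have XK u : unit_sphere u -> aK ^+ n <= radial K u ^+ n <= bK ^+ n.
  move=> /abK /andP[ar rb]; have r0 := lt_le_trans aK0 ar.
  by rewrite !lerXn2r// nnegrE ltW// (lt_le_trans r0).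
have XL u : unit_sphere u -> aL ^+ n <= radial L u ^+ n <= bL ^+ n.
  move=> /abL /andP[ar rb]; have r0 := lt_le_trans aL0 ar.
  by rewrite !lerXn2r// nnegrE ltW// (lt_le_trans r0).
have aKn : 0 < aK ^+ n by rewrite exprn_gt0.
have aLn : 0 < aL ^+ n by rewrite exprn_gt0.
have [p pS] := unit_sphere_nonempty n_gt0 (R := R).
have bKn : 0 < bK ^+ n by have /andP[H1 H2] := XK p pS;
  exact: lt_le_trans (lt_le_trans aKn H1) H2.
have [M MP] := convex_bounded (bL ^+ n / aK ^+ n) cG (divr_gt0 aLn bKn).
have ratio u : unit_sphere u ->
    aL ^+ n / bK ^+ n <= radial L u ^+ n / radial K u ^+ n <= bL ^+ n / aK ^+ n.
  move=> uS; have /andP[K1 K2] := XK u uS; have /andP[L1 L2] := XL u uS.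
  have k0 := lt_le_trans aKn K1; have l0 := lt_le_trans aLn L1.
  apply/andP; split; apply: ler_pM; by rewrite ?invr_ge0 ?lef_pV2 ?posrE// ltW.
have mK : measurable_fun unit_sphere (fun u => radial K u ^+ n).
  by apply: measurable_funX; exact: radial_measurable.
have mL : measurable_fun unit_sphere (fun u => radial L u ^+ n).
  by apply: measurable_funX; exact: radial_measurable.
apply: measurable_bounded_integrable.
- exact: measurable_unit_sphere.
- exact: spherical_measure_sphere_fin.
- apply: measurable_funM => //.
  apply: (@measurable_comp _ _ _ _ _ _ posR G).
  + exact: measurable_itv.
  + move=> _ [u uS <-]; rewrite /posR /= in_itv/= andbT.
    by have /andP[+ _] := ratio u uS; apply: lt_le_trans; exact: divr_gt0.
  + exact: convex_measurable.
  + apply: measurable_funM => //.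
    (* The inverse is replaced by the power -1, a measurable function that agrees with it on
       positive values. *)
    apply: (eq_measurable_fun (fun u => (radial K u ^+ n) `^ (-1))).
      move=> u; rewrite inE => uS; rewrite powR_inv1//.
      by have /andP[+ _] := XK u uS; apply: le_trans; exact: ltW.
    by apply: (measurableT_comp (measurable_powR _)).
- exists (M * bK ^+ n); split=> [|B hB u uS /=]; first exact: num_real.
  have /andP[K1 K2] := XK u uS.
  rewrite (le_trans _ (ltW hB))// normrM ler_pM// ?MP ?ratio//.
  by rewrite ger0_norm// (le_trans (ltW aKn)).
Qed.

(** * The inequality and its equality case for a convex function of any sign *)

Section convex_dual_mixed_volume.
Variables (G : R -> R) (K L : set 'rV[R]_n).
Hypotheses (cG : convex_function posR G) (hK : star_body K) (hL : star_body L).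

Let intG := \int[@spherical_measure R n]_(u in unit_sphere)
  (G (radial L u ^+ n / radial K u ^+ n) * radial K u ^+ n).

Let nR_gt0 : 0 < n%:R :> R. Proof. by rewrite ltr0n. Qed.
Let vK := volume_gt0 n_gt0 hK.
Let vL := volume_gt0 n_gt0 hL.
Let rK u : unit_sphere u -> 0 < radial K u. Proof. by case: hK => _ _ _;
  exact. Qed.
Let rL u : unit_sphere u -> 0 < radial L u. Proof. by case: hL => _ _ _;
  exact. Qed.
Let iK := integrable_radialX n_gt0 hK.
Let iL := integrable_radialX n_gt0 hL.
Let iG := integrable_convex_ratio cG hK hL.
Let XK u : unit_sphere u -> 0 < radial K u ^+ n.
Proof. by move=> uS; rewrite exprn_gt0 ?rK. Qed.
Let XL u : unit_sphere u -> 0 < radial L u ^+ n.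
Proof. by move=> uS; rewrite exprn_gt0 ?rL. Qed.
Let IK : 0 < \int[@spherical_measure R n]_(u in unit_sphere) radial K u ^+ n.
Proof. by rewrite -volume_polar// mulr_gt0. Qed.
Let IL : 0 < \int[@spherical_measure R n]_(u in unit_sphere) radial L u ^+ n.
Proof. by rewrite -volume_polar// mulr_gt0. Qed.

Let volume_ratio : n%:R * volume L / (n%:R * volume K) = volume L / volume K.
Proof. by rewrite invfM mulrACA mulfV// mul1r. Qed.

(** [G] is general because it is later taken to be both [F] and [-F]. The factors [n] of the polar
    formula cancel in the barycenter, leaving [|L| / |K|]. *)
Lemma convex_dual_mixed_volume_ge :
  volume K * G (volume L / volume K) <= n%:R^-1 * intG.
Proof.
have := weighted_jensen measurable_unit_sphere iK iL iG XK XL IK IL cG.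
rewrite -!volume_polar// volume_ratio => H.
by rewrite ler_pdivlMl// mulrA mulrC.
Qed.

Lemma convex_dual_mixed_volume_eq : strictly_convex_function posR G ->
  n%:R^-1 * intG = volume K * G (volume L / volume K) <-> dilates K L.
Proof.
move=> sG; rewrite dilatesP//; split => [E|[l l0 lP]].
  have IE : intG = G (volume L / volume K) * (n%:R * volume K).
    by rewrite -[LHS](mulVKf n0) E; ring.
  have := weighted_jensen_eq measurable_unit_sphere iK iL iG XK XL IK IL cG sG.
  rewrite -!volume_polar// volume_ratio => /(_ IE) ae.
  pose t := volume L / volume K; have t0 : 0 < t by exact: divr_gt0.
  (* Jensen's equality case compares n-th powers, so the dilation factor is the n-th root of the
     volume ratio. *)
  pose l := t `^ n%:R^-1; have l0 : 0 < l by exact: powR_gt0.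
  have ln : l ^+ n = t by rewrite -powR_mulrn ?ltW// -powRrM mulVf// powRr1//
    ltW.
  exists l => // u uS; apply/eqP; rewrite -subr_eq0; apply/eqP.
  move: u uS; apply: ae_unit_sphere_eq0.
    case: hK hL => [_ _ /subspace_continuousP cK _] [_ _ /subspace_continuousP
      cL _].
    apply/subspace_continuousP => u uS.
    apply: cvgB; first exact: cL.
    by apply: cvgM; [exact: cvg_cst|exact: cK].
  apply: filterS ae => u + uS => /(_ uS); rewrite -/t -ln -exprMn => /eqP.
  rewrite eqrXn2// ?mulr_ge0 ?ltW ?rK ?rL// => /eqP ->.
  by rewrite subrr.
(* For dilates the ratio of n-th powers is the constant [l ^+ n], which is also the volume ratio, so
   both sides become [|K| G(l^n)]. *)
have LK : n%:R * volume L = l ^+ n * (n%:R * volume K).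
  rewrite !volume_polar// -RintegralZl//; last exact: measurable_unit_sphere.
  by apply: eq_Rintegral => u; rewrite inE => uS; rewrite lP// exprMn.
have tE : volume L / volume K = l ^+ n.
  by rewrite -volume_ratio LK mulfK// mulf_neq0// gt_eqF.
rewrite tE /intG (@eq_Rintegral _ _ _ _ _ (fun u => G (l ^+ n) * radial K u ^+
  n)).
  rewrite RintegralZl//; last exact: measurable_unit_sphere.
  by rewrite -volume_polar//; field.
move=> u; rewrite inE => uS; rewrite lP// exprMn mulfK//.
by rewrite gt_eqF// XK.
Qed.

End convex_dual_mixed_volume.

Lemma dual_mixed_volumeE phi K L : star_body K -> star_body L ->
  dual_mixed_volume phi K L = n%:R^-1 * \int[@spherical_measure R n]_(u in
    unit_sphere)
  (orlicz_F n phi (radial L u ^+ n / radial K u ^+ n) * radial K u ^+ n).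
Proof.
move=> [_ _ _ rK] [_ _ _ rL]; rewrite /dual_mixed_volume; congr (_ * _).
by apply: eq_Rintegral => u; rewrite inE => uS; rewrite orlicz_F_ratio ?rK ?rL.
Qed.

(** This merges the constant alternative in [Phi] and [Psi] with the convex one. *)
Lemma constant_on_convex G : constant_on posR G -> convex_function posR G.
Proof.
move=> [c Gc] t x y; rewrite !posRE => x0 y0.
rewrite !Gc ?posRE//; last exact: convR_gt0.
by rewrite convmm.
Qed.

End dual_mixed_volume_theory.

Theorem theorem4p1 (R : realType) (n : nat) (n_gt0 : (0 < n)%N)
    (K L : set 'rV[R]_n) (hK : star_body K) (hL : star_body L) :
  (forall phi : R -> R, Phi n phi ->
     volume K * phi (volume K `^ n%:R^-1 * volume L `^ (- n%:R^-1))
       <= dual_mixed_volume phi K L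
     /\ (strictly_convex_function posR (orlicz_F n phi) ->
         (dual_mixed_volume phi K L =
            volume K * phi (volume K `^ n%:R^-1 * volume L `^ (- n%:R^-1))
          <-> dilates K L)))
  /\
  (forall phi : R -> R, Psi n phi ->
     dual_mixed_volume phi K L
       <= volume K * phi (volume K `^ n%:R^-1 * volume L `^ (- n%:R^-1))
     /\ (strictly_concave_function posR (orlicz_F n phi) ->
         (dual_mixed_volume phi K L =
            volume K * phi (volume K `^ n%:R^-1 * volume L `^ (- n%:R^-1))
          <-> dilates K L))).
Proof.
have [vK vL] := (volume_gt0 n_gt0 hK, volume_gt0 n_gt0 hL).
split=> phi [_ phiP]; rewrite dual_mixed_volumeE// -orlicz_F_volume//.
  have cF : convex_function posR (orlicz_F n phi).
    by case: phiP => // /constant_on_convex.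
  by split; [exact: convex_dual_mixed_volume_ge|exact:
    convex_dual_mixed_volume_eq].
(* The concave case is the convex one applied to [-F]: the sign reverses the inequality and
   preserves equality. *)
pose G x := - orlicz_F n phi x.
have cG : convex_function posR G.
  case: phiP => [[c Fc]|[]//]; apply: constant_on_convex.
  by exists (- c) => t t0; rewrite /G Fc.
have iG := integrable_convex_ratio n_gt0 cG hK hL.
set I := (X in n%:R^-1 * X).
have -> : I = -1 * \int[@spherical_measure R n]_(u in unit_sphere)
    (G (radial L u ^+ n / radial K u ^+ n) * radial K u ^+ n).
  rewrite -RintegralZl//; last exact: measurable_unit_sphere.
  by apply: eq_Rintegral => u _; rewrite /G mulN1r mulNr opprK.
rewrite mulN1r mulrN -[orlicz_F n phi _]opprK -/(G _) [volume K * _]mulrN lerN2.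
split; first exact: convex_dual_mixed_volume_ge.
move=> sG; rewrite -(convex_dual_mixed_volume_eq n_gt0 cG hK hL sG).
by split => [/oppr_inj|->].
Qed.
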